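(* Let $L:(I,q)\to\mathbb{P}(\mathcal{L})$ be a closed polarised curve of finite type with period $T$, admitting a polynomial conserved quantity $p^t$ which is periodic with the same period $T$. Let $\mathcal{M}^\mu$ denote the monodromy matrix of Darboux transforms of $L$ with spectral parameter $\mu$. Let $\mu\in\mathbb{R}\setminus\{0\}$ be chosen so that $\mathcal{M}^\mu$ is diagonalisable, and denote by $\hat L_1=\langle\hat X_1\rangle$, $\hat L_2=\langle \hat X_2\rangle$ the two closed Darboux transforms of $L$ with spectral parameter $\mu$, where $\hat X_i$ are $\mathrm{d}^\mu$-parallel sections. If $(p^\mu,\hat X_1)\neq 0$ (this function is constant), then the eigenvalues of $\mathcal{M}^\mu$ must be $$1,\quad \lambda^\mu,\quad \bar\lambda^\mu$$ for some $\lambda^\mu\in\mathbb{S}^1\subset\mathbb{C}$. Furthermore, $L$ admits a resonance point on some multiple cover of $L$.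
   Context: Setting. $\mathbb{R}^{3,1}$ is $\mathbb{R}^4$ with a symmetric bilinear form $(\cdot,\cdot)$ of signature $(-+++)$; $\mathcal{L}=\{X\in\mathbb{R}^{3,1}:(X,X)=0\}$ is the lightcone, and $\mathbb{P}(\mathcal{L})$ is its projectivisation (the lines $\langle X\rangle$ with $0\ne X\in\mathcal{L}$), the conformal $2$-sphere. For $x,y\in\mathbb{R}^{3,1}$, $x\wedge y\in\mathfrak{o}(3,1)$ is the map $(x\wedge y)v=(x,v)y-(y,v)x$. Polarised curve: $I$ is an open interval (for closed curves identified with the universal cover $\mathbb{R}$), $q$ is a non-vanishing quadratic differential on $I$, i.e. $q=\frac1m\,\mathrm{d}s^2$ in a coordinate $s$ with $m$ a non-vanishing real function, and $L:(I,q)\to\mathbb{P}(\mathcal{L})$ is a (smooth) regular curve, regarded as a line subbundle of $I\times\mathbb{R}^{3,1}$. $\Gamma L$ denotes its sections $X$, taken nowhere vanishing, so $L=\langle X\rangle$. $L$ is closed with period $T>0$ if $L$ and $q$ are $T$-periodic in $s$. Associated flat connections: $\mathrm{d}^t=\mathrm{d}+t\eta$, $t\in\mathbb{R}$, where $\eta=q\,\frac{X\wedge \mathrm{d}X}{(\mathrm{d}X,\mathrm{d}X)}$ for any $X\in\Gamma L$ (independent of the choice of $X$); explicitly $\eta(\partial_s)=\frac1m\frac{X\wedge X'}{(X',X')}$. Darboux transform: $\hat L=\langle\hat X\rangle:(I,q)\to\mathbb{P}(\mathcal{L})$ is a Darboux transform of $L$ with spectral parameter $\mu\in\mathbb{R}\setminus\{0\}$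 if $(\mathrm{d}+\mu\eta)\hat X=0$ for some section $\hat X\in\Gamma\hat L$. Polynomial conserved quantity: $p^t=p_0+p_1t+\dots+p_dt^d$, with $p_n:I\to\mathbb{R}^{3,1}$ smooth, such that $(\mathrm{d}+t\eta)p^t=0$ for all $t$. Monodromy: for $\mu\in\mathbb{R}$ let $A^\mu:I\to\mathrm{SO}(3,1)$ solve $\frac{\mathrm{d}}{\mathrm{d}s}A^\mu=-\mu\,\eta(\partial_s)A^\mu$, $A^\mu(0)=\mathrm{id}$, and put $\mathcal{M}^\mu:=A^\mu(T)$. Parallel sections of $\mathrm{d}^\mu$ are $\hat X=A^\mu\hat X_0$; if $\hat X_0\in\mathcal{L}$ is an eigenvector of $\mathcal{M}^\mu$ then $\langle\hat X\rangle$ is a closed Darboux transform of period $T$. ''Diagonalisable'' means diagonalisable over $\mathbb{C}$. If $\mathcal{M}^\mu$ is diagonalisable, it has two linearly independent lightlike eigenvectors with reciprocal real eigenvalues; ''the two closed Darboux transforms'' are the ones generated by these two eigenvectors as initial conditions. Finite type: the set $\{\mu\in\mathbb{R}:\mathcal{M}^\mu\text{ is non-diagonalisable}\}$ is finite. Resonance point: a spectral parameter $\mu\in\mathbb{R}\setminus\{0\}$ such that $\mathcal{M}^\mu$ is diagonalisable with single eigenvalue $1$ of multiplicity $4$ (i.e. $\mathcal{M}^\mu=\mathrm{id}$). A resonance point on a multiple cover of $L$ is a $\mu\in\mathbb{R}\setminus\{0\}$ for which there is an integer $\ell\ge1$ with $(\mathcal{M}^\mu)^\ell=\mathrm{id}$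 (a resonance point for the $\ell$-fold cover, of period $\ell T$). *)

(* Defs.v *)
From mathcomp Require Import all_boot all_order all_algebra.
From mathcomp Require Import complex.
From mathcomp Require Import boolp classical_sets cardinality reals topology normedtype derive.
Set Implicit Arguments.
Unset Strict Implicit.
Unset Printing Implicit Defensive.
Import Order.TTheory GRing.Theory Num.Theory.
Import numFieldNormedType.Exports.
Local Open Scope ring_scope.
Local Open Scope classical_set_scope.

Section Lorentz.
Variable R : realType.

(* R^{3,1}: column vectors of R^4 with the form diag(-1, 1, 1, 1). *)
Definition mink_mx : 'M[R]_4 :=
  diag_mx (\row_(i < 4) (if i == ord0 then -1 else 1)).

Definition mink (x y : 'cV[R]_4) : R := (x^T *m mink_mx *m y) ord0 ord0.

Lemma minkE (x y : 'cV[R]_4) :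
  mink x y = - (x ord0 ord0 * y ord0 ord0)
             + \sum_(i < 3) x (lift ord0 i) ord0 * y (lift ord0 i) ord0.
Proof.
rewrite /mink mxE big_ord_recl; congr (_ + _).
  rewrite mxE (bigD1 ord0) //= big1 ?addr0; last first.
    by move=> i ni0; rewrite !mxE (negPf ni0) mulr0n mulr0.
  by rewrite !mxE eqxx mulr1n mulrN1 mulNr.
apply: eq_bigr => i _; congr (_ * _).
rewrite mxE (bigD1 (lift ord0 i)) //= big1 ?addr0; last first.
  by move=> j nj; rewrite !mxE (negPf nj) mulr0n mulr0.
by rewrite !mxE eqxx mulr1n mulr1.
Qed.

(* The matrix of v |-> (x, v) y - (y, v) x; see wedgeE. *)
Definition wedge (x y : 'cV[R]_4) : 'M[R]_4 :=
  (y *m x^T - x *m y^T) *m mink_mx.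

Lemma wedgeE (x y v : 'cV[R]_4) :
  wedge x y *m v = mink x v *: y - mink y v *: x.
Proof.
have H (a b : 'cV[R]_4) : b *m a^T *m mink_mx *m v = mink a v *: b.
  rewrite -!mulmxA mulmxA; apply/colP => i.
  by rewrite -mulmxA mxE big_ord1 [RHS]mxE mulrC /mink mulmxA.
by rewrite /wedge mulmxBl mulmxBl !H.
Qed.

Definition smooth (V : normedModType R) (f : R -> V) : Prop :=
  forall (n : nat) (s : R), derivable (derive1n n f) s 1.

(* The curves considered are closed, so their domain is the universal cover R.
   A curve of lines is a map L : R -> {vspace 'cV[R]_4}. *)

Definition line_section (L : R -> {vspace 'cV[R]_4}) (X : R -> 'cV[R]_4) :
    Prop :=
  smooth X /\ forall s, X s != 0 /\ L s = <[X s]>%VS.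

Definition lightlike (L : R -> {vspace 'cV[R]_4}) : Prop :=
  forall s x, x \in L s -> mink x x = 0.

(* The polarisation is q = ds^2 / m. Regularity of L = <X> as a curve in
   projective space means that X' is nowhere a multiple of X. *)
Definition polarised_curve (m : R -> R) (L : R -> {vspace 'cV[R]_4})
    (X : R -> 'cV[R]_4) : Prop :=
  [/\ smooth (m : R -> R^o) /\ (forall s, m s != 0),
      line_section L X,
      lightlike L &
      forall s, derive1 X s \notin L s].

Definition closed_curve (T : R) (m : R -> R) (L : R -> {vspace 'cV[R]_4}) :
    Prop :=
  0 < T /\ forall s, m (s + T) = m s /\ L (s + T) = L s.

(* eta(d/ds); the denominator is nonzero on a polarised curve, where X' is
   orthogonal to the lightlike X and not proportional to it. *)
Definition eta (m : R -> R) (X : R -> 'cV[R]_4) (s : R) : 'M[R]_4 :=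
  ((m s)^-1 / mink (derive1 X s) (derive1 X s)) *: wedge (X s) (derive1 X s).

Definition parallel (m : R -> R) (X : R -> 'cV[R]_4) (mu : R)
    (Y : R -> 'cV[R]_4) : Prop :=
  forall s, derive1 Y s + mu *: (eta m X s *m Y s) = 0.

(* Lh is the Darboux transform <Xh> of <X> with spectral parameter mu. *)
Definition darboux_transform (m : R -> R) (X : R -> 'cV[R]_4) (mu : R)
    (Lh : R -> {vspace 'cV[R]_4}) (Xh : R -> 'cV[R]_4) : Prop :=
  [/\ mu != 0, line_section Lh Xh, lightlike Lh & parallel m X mu Xh].

Definition poly_at (d : nat) (p : 'I_d.+1 -> R -> 'cV[R]_4) (t : R) (s : R) :
    'cV[R]_4 :=
  \sum_(n < d.+1) t ^+ n *: p n s.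

Definition polynomial_conserved_quantity (m : R -> R) (X : R -> 'cV[R]_4)
    (d : nat) (p : 'I_d.+1 -> R -> 'cV[R]_4) : Prop :=
  (forall n, smooth (p n)) /\ forall t, parallel m X t (poly_at p t).

(* The solution A takes values in SO(3,1) automatically. *)
Definition parallel_frames (m : R -> R) (X : R -> 'cV[R]_4)
    (A : R -> R -> 'M[R]_4) : Prop :=
  forall mu, A mu 0 = 1%:M /\
    forall s : R, is_derive s (1 : R) (A mu) (- mu *: (eta m X s *m A mu s)).

Definition monodromy (A : R -> R -> 'M[R]_4) (T : R) (mu : R) : 'M[R]_4 :=
  A mu T.

Definition complexify (M : 'M[R]_4) : 'M[R[i]]_4 := map_mx (real_complex R) M.

Definition diagonalizableC (M : 'M[R]_4) : Prop :=
  diagonalizable (complexify M).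

Definition finite_type (A : R -> R -> 'M[R]_4) (T : R) : Prop :=
  finite_set [set mu : R | ~ diagonalizableC (monodromy A T mu)].

Definition is_eigenvector (M : 'M[R]_4) (v : 'cV[R]_4) : Prop :=
  v != 0 /\ exists c : R, M *m v = c *: v.

(* nu is a resonance point of the l-fold cover, whose period is l * T. *)
Definition multiple_cover_resonance_point (A : R -> R -> 'M[R]_4) (T : R)
    (nu : R) : Prop :=
  nu != 0 /\ exists l : nat, (0 < l)%N /\ monodromy A T nu ^+ l = 1.

End Lorentz.

(* Main.v *)
(** The monodromies M^t lie in SO(3,1) and M^t fixes p^t(0). A fixed vector
    forces the spectrum of an element of SO(3,1) to be (1, 1, x, 1/x). At [mu]
    the constant (p^mu, X_1) is nonzero, so X_1, and then X_2 as (X_1, X_2) is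
    nonzero, is fixed too; the form is positive definite on the complement of
    their span, whence |x| = 1.

    If x = 1 at [mu], then M^mu = id. Otherwise tr M^mu < 4. As tr M^t is
    continuous in t with value 4 at t = 0, it takes the value
    2 + 2 cos (2 pi / n) for every large n. Only finitely many of these
    parameters are non-diagonalisable or have p^t(0) = 0; at any other one x is
    an n-th root of unity, so (M^t)^n = id. *)

Require Import Defs.
From mathcomp Require Import all_boot all_order all_algebra.
From mathcomp Require Import complex ring lra.
From mathcomp Require Import boolp classical_sets functions cardinality reals.
From mathcomp Require Import topology normedtype sequences derive realfun.
From mathcomp Require Import exp trigo.
Import Order.TTheory GRing.Theory Num.Theory.
Import numFieldNormedType.Exports.
Local Open Scope ring_scope.

(** * The Minkowski form *)
Section Minkowski.
Variable R : realType.
Implicit Types (x y z : 'cV[R]_4) (M : 'M[R]_4).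

Lemma mink_mx_sqr : mink_mx R *m mink_mx R = 1%:M.
Proof.
rewrite /mink_mx mulmx_diag -diag_const_mx; congr diag_mx.
by apply/rowP => i; rewrite !mxE; case: ifP => _; rewrite ?mulrNN mulr1.
Qed.

Lemma tr_mink_mx : (mink_mx R)^T = mink_mx R.
Proof. by rewrite /mink_mx tr_diag_mx. Qed.

Lemma minkC x y : mink x y = mink y x.
Proof.
rewrite /mink -[RHS]trace_mx11 -mxtrace_tr trace_mx11.
by rewrite !trmx_mul trmxK tr_mink_mx mulmxA.
Qed.

Lemma minkDr x y z : mink x (y + z) = mink x y + mink x z.
Proof. by rewrite /mink mulmxDr mxE. Qed.

Lemma minkZr a x y : mink x (a *: y) = a * mink x y.
Proof. by rewrite /mink -scalemxAr mxE. Qed.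

Lemma minkDl x y z : mink (x + y) z = mink x z + mink y z.
Proof. by rewrite !(minkC _ z) minkDr. Qed.

Lemma minkZl a x y : mink (a *: x) y = a * mink x y.
Proof. by rewrite !(minkC _ y) minkZr. Qed.

Lemma mink_mulmxr M x y : mink x (M *m y) = (x^T *m (mink_mx R *m M) *m y) 0 0.
Proof. by rewrite /mink !mulmxA. Qed.

(** Nondegeneracy: [mink_mx] is its own inverse, and basis vectors read off coordinates. Vector
    identities below are proved by pairing with an arbitrary [z]. *)
Lemma mink_ext x y : (forall z, mink z x = mink z y) -> x = y.
Proof.
move=> h; have /mulmx1_unit[uJ _] := mink_mx_sqr.
apply: (can_inj (mulKmx uJ)); apply/colP => i; have := h (delta_mx i 0).
by rewrite /mink -!mulmxA trmx_delta -!rowE [LHS]mxE [RHS]mxE.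
Qed.

(** This puts [eta] in the Lorentz algebra, which is why parallel sections have constant
    pairings. *)
Lemma wedge_skew u v x y : mink (wedge u v *m x) y = - mink x (wedge u v *m y).
Proof.
rewrite !wedgeE minkDl minkDr -!scaleNr !minkZl !minkZr !(minkC x).
by ring.
Qed.

Lemma mink_spatial x : x ord0 ord0 = 0 ->
  0 <= mink x x /\ (mink x x = 0 -> x = 0).
Proof.
move=> x0; rewrite minkE x0 mul0r oppr0 add0r.
have sq_ge0 (i : 'I_3) : 0 <= x (lift ord0 i) ord0 * x (lift ord0 i) ord0.
  by rewrite -expr2 sqr_ge0.
split=> [|/eqP]; first by apply: sumr_ge0.
rewrite psumr_eq0 // => /allP xs; apply/colP => i; rewrite mxE.
case: (unliftP ord0 i) => [j ->|-> //].
by have /eqP/eqP := xs j (mem_index_enum _); rewrite mulf_eq0 orbb => /eqP.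
Qed.

(** The multiple [k] of [x] cancels the time coordinate of [y]. Then [y + k *: x] is spatial with
    square (y,y) + k^2 (x,x) >= 0, and (x,x) < 0. *)
Lemma mink_timelike_ortho x y : mink x x < 0 -> mink x y = 0 ->
  0 <= mink y y /\ (mink y y = 0 -> y = 0).
Proof.
move=> xx xy.
have x0 : x ord0 ord0 != 0.
  by apply: contraTneq xx => /mink_spatial[? _]; rewrite -leNgt.
pose k := - (y ord0 ord0 / x ord0 ord0).
have /mink_spatial : (y + k *: x) ord0 ord0 = 0.
  by rewrite !mxE /k mulNr divfK // subrr.
rewrite minkDl !minkDr !minkZl !minkZr (minkC y) xy !(mulr0, addr0,
  add0r) mulrA.
have kx : 0 <= - (k * k * mink x x) by rewrite -mulrN mulr_ge0 ?oppr_ge0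
  -?expr2 ?sqr_ge0 ?ltW.
case=> z0 z; split; first lra.
move=> yy; have /eqP : k * k * mink x x = 0 by lra.
rewrite mulf_eq0 (lt_eqF xx) orbF mulf_eq0 orbb => /eqP k0.
by move: z; rewrite yy k0 scale0r !(mul0r, addr0) => /(_ erefl).
Qed.

(** Again a multiple of [x] makes [y] spatial; the sum is still null, hence zero. *)
Lemma lightlike_ortho {x} y : mink x x = 0 -> x != 0 ->
  mink x y = 0 -> mink y y = 0 -> y \in <[x]>%VS.
Proof.
move=> xx xn0 xy yy.
have x0 : x ord0 ord0 != 0.
  by apply: contraNneq xn0 => /mink_spatial[_ ->].
pose k := - (y ord0 ord0 / x ord0 ord0).
have /mink_spatial[_] : (y + k *: x) ord0 ord0 = 0.
  by rewrite !mxE /k mulNr divfK // subrr.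
rewrite minkDl !minkDr !minkZl !minkZr (minkC y) xy xx yy !(mulr0, addr0).
move=> /(_ erefl)/eqP; rewrite addr_eq0 => /eqP ->.
by rewrite -scaleNr memvZ // memv_line.
Qed.

Lemma lightlike_pair_ortho x y a : mink x x = 0 -> mink y y = 0 ->
  mink x y != 0 -> mink x a = 0 -> mink y a = 0 ->
  0 <= mink a a /\ (mink a a = 0 -> a = 0).
Proof.
move=> xx yy xy xa ya; pose k := - mink x y.
(* [x - (x, y) y] is timelike. *)
apply: (@mink_timelike_ortho (x + k *: y)).
  rewrite minkDl !minkDr !minkZl !minkZr (minkC y) xx yy !(mulr0, addr0, add0r).
  rewrite /k; have : 0 < mink x y * mink x y by rewrite -expr2 exprn_even_gt0.
  lra.
by rewrite minkDl minkZl xa ya mulr0 addr0.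
Qed.

End Minkowski.

(** * Spectra of Lorentz transformations *)
Section Spectrum.

(** As abc = 1, the sum of inverses is the second symmetric function e2. So e1 = e2, and (1 - a)(1 -
    b)(1 - c) = 1 - e1 + e2 - abc vanishes. *)
Lemma reciprocal_triple (F : fieldType) (a b c : F) :
  a * (b * c) = 1 -> a + (b + c) = a^-1 + (b^-1 + c^-1) -> 1 \in [:: a; b; c].
Proof.
move=> abc1 sE.
have abc0 : a * (b * c) != 0 by rewrite abc1 oner_eq0.
have := abc0; rewrite !mulf_eq0 !negb_or => /and3P[a0 b0 c0].
have e2 : a + (b + c) = a * b + a * c + b * c.
  have -> : a * b + a * c + b * c = b * c + (a * c + a * b) by ring.
  by rewrite sE; congr (_ + (_ + _)); [apply: (mulfI a0) | apply: (mulfI b0) |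
    apply: (mulfI c0)]; rewrite mulfV // -abc1; ring.
have : (1 - a) * ((1 - b) * (1 - c)) = 0.
  transitivity (1 - (a + (b + c)) + (a * b + a * c + b * c) - a * (b * c)).
    by ring.
  by rewrite e2 abc1; ring.
by move/eqP; rewrite !mulf_eq0 !subr_eq0 !inE.
Qed.

(** Removing the given 1 leaves a reciprocal triple, which contains another 1; the last two entries
    have product 1. *)
Lemma reciprocal_spectrum (F : fieldType) (s : seq F) :
  size s = 4 -> 1 \in s -> \prod_(z <- s) z = 1 ->
  \sum_(z <- s) z = \sum_(z <- s) z^-1 ->
  exists x, perm_eq s [:: 1; 1; x; x^-1].
Proof.
move=> sz s1; have [t ps] : exists t, perm_eq s (1 :: t).
  by exists (rem 1 s); apply: perm_to_rem.
rewrite !(perm_big _ ps) !big_cons /= invr1 mul1r.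
move: (perm_size ps); rewrite sz => -[]; case: t ps =>
  [|a [|b [|c [|//]]]] //= ps _.
rewrite !big_cons !big_nil mulr1 !addr0 => abc1 /addrI sE.
have t1 := reciprocal_triple _ _ _ _ abc1 sE.
have {t1} [u pt] : exists u, perm_eq [:: a; b; c] (1 :: u).
  by exists (rem 1 [:: a; b; c]); apply: perm_to_rem.
have : \prod_(z <- [:: a; b; c]) z = 1 by rewrite !big_cons big_nil mulr1.
move: (perm_size pt); rewrite (perm_big _ pt) big_cons /= mul1r.
case: u pt => [|x [|y [|? ?]]] //= pt _.
rewrite !big_cons big_nil mulr1 => xy1; exists x.
have -> : x^-1 = y.
  have x0 : x != 0 by apply: contra_eq_neq xy1 => ->;
    rewrite mul0r eq_sym oner_eq0.
  by apply: (mulfI x0); rewrite xy1 mulfV.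
by rewrite (perm_trans ps) // perm_cons.
Qed.

Variable R : realType.
Implicit Types (M : 'M[R]_4).

Definition lorentz M := forall x y, mink (M *m x) (M *m y) = mink x y.

Lemma lorentz_mxP M : lorentz M -> M^T *m mink_mx R *m M = mink_mx R.
Proof.
move=> hM; apply/matrixP => i j.
have := hM (delta_mx i 0) (delta_mx j 0).
rewrite /mink trmx_mul trmx_delta -!mulmxA.
have H (B : 'M[R]_4) : ((delta_mx 0 i : 'rV_4) *m (B *m (delta_mx j 0 :
  'cV_4))) 0 0 = B i j.
  by rewrite -rowE mxE -colE mxE.
by rewrite (mulmxA (mink_mx R) M) (mulmxA M^T (_ *m M)) !H mulmxA.
Qed.

Lemma lorentz_inv M : lorentz M -> (mink_mx R *m M^T *m mink_mx R) *m M = 1%:M.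
Proof.
by move/lorentz_mxP => h; rewrite -!mulmxA (mulmxA M^T) h mink_mx_sqr.
Qed.

Lemma lorentz_unitmx M : lorentz M -> M \in unitmx.
Proof. by move/lorentz_inv/mulmx1_unit => -[]. Qed.

(** The inverse is the transpose conjugated by the involution [mink_mx]. *)
Lemma lorentz_trmxV M : lorentz M -> \tr (invmx M) = \tr M.
Proof.
move=> hM; have uM := lorentz_unitmx _ hM.
have -> : invmx M = mink_mx R *m M^T *m mink_mx R.
  by apply: (can_inj (mulmxK uM)); rewrite mulVmx // lorentz_inv.
by rewrite mxtrace_mulC mulmxA mink_mx_sqr mul1mx mxtrace_tr.
Qed.

Lemma diagonalizableCP (M : 'M[R]_4) : diagonalizableC M ->
  exists (P : 'M[R[i]]_4) (d : 'rV[R[i]]_4),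
    P \in unitmx /\ complexify M = invmx P *m diag_mx d *m P.
Proof.
case=> P uP /(similar_diagLR uP)[d Md]; exists P, d; split=> //.
by rewrite Md conjVmx.
Qed.

Lemma eigenvalue_diag (F : fieldType) n (P : 'M[F]_n.+1) (d : 'rV_n.+1) a :
  P \in unitmx ->
  eigenvalue (invmx P *m diag_mx d *m P) a =
    (a \in [seq d 0 i | i <- enum 'I_n.+1]).
Proof.
move=> uP; rewrite eigenvalue_root_min -conjVmx // mxminpoly_uconj ?unitmx_inv
  //.
by rewrite mxminpoly_diag root_prod_XsubC mem_undup.
Qed.

Lemma det_conj_diag (F : fieldType) n (P : 'M[F]_n) (d : 'rV_n) :
  P \in unitmx ->
  \det (invmx P *m diag_mx d *m P) =
    \prod_(z <- [seq d 0 i | i <- enum 'I_n]) z.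
Proof.
move=> uP; rewrite !det_mulmx mulrC mulrA -det_mulmx mulmxV // det1 mul1r.
by rewrite det_diag big_map big_enum.
Qed.

Lemma trace_conj_diag (F : fieldType) n (P : 'M[F]_n) (d : 'rV_n) :
  P \in unitmx ->
  \tr (invmx P *m diag_mx d *m P) = \sum_(z <- [seq d 0 i | i <- enum 'I_n]) z.
Proof.
move=> uP; rewrite mxtrace_mulC mulmxA mulmxV // mul1mx.
by rewrite mxtrace_diag big_map big_enum.
Qed.

(** The diagonal entries satisfy [reciprocal_spectrum]: the fixed vector supplies a 1, the
    determinant the product, and [lorentz_trmxV] the two equal sums. The diagonalisation is returned
    as well, since traces, powers and eigenvectors are computed from it. *)
Lemma lorentz_spectrum M (v : 'cV[R]_4) : lorentz M -> \det M = 1 -> v != 0 ->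
  M *m v = v ->
  diagonalizableC M ->
  exists (x : R[i]) (P : 'M[R[i]]_4) (d : 'rV[R[i]]_4),
    [/\ P \in unitmx, x != 0,
    complexify M = invmx P *m diag_mx d *m P &
    perm_eq [seq d 0 i | i <- enum 'I_4] [:: 1; 1; x; x^-1]].
Proof.
move=> hM detM v0 Mv /diagonalizableCP[P [d [uP Md]]].
have uM := lorentz_unitmx _ hM.
have uMC : complexify M \in unitmx by rewrite map_unitmx.
have dn0 i : d 0 i != 0.
  have : diag_mx d \in unitmx.
    have -> : diag_mx d = P *m complexify M *m invmx P.
      by rewrite Md !mulmxA mulmxV // mul1mx mulmxK.
    by rewrite !unitmx_mul uP uMC unitmx_inv.
  rewrite unitmxE det_diag unitfE => /prodf_neq0; exact.
have MVd : complexify (invmx M) = invmx P *m diag_mx (map_mx GRing.inv d) *m P.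
  rewrite /complexify map_invmx; apply: (can_inj (mulmxK uMC)).
  rewrite mulVmx // Md !mulmxA (mulmxK uP) -(mulmxA (invmx P)) mulmx_diag.
  suff -> : \row_j (map_mx GRing.inv d 0 j * d 0 j) = const_mx 1.
    by rewrite diag_const_mx mulmx1 mulVmx.
  by apply/rowP => j; rewrite !mxE mulVf.
have [||||x hx] := @reciprocal_spectrum _ [seq d 0 i | i <- enum 'I_4].
- by rewrite size_map size_enum_ord.
(* In the eigenbasis the fixed vector becomes [w]; any nonzero coordinate of [w] sits at a diagonal
   entry equal to 1. *)
- pose w := P *m map_mx (real_complex R) v.
  have w0 : w != 0.
    apply: contraNneq v0 => /(congr1 (mulmx (invmx P))).
    by rewrite mulKmx // mulmx0 => /eqP; rewrite map_mx_eq0.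
  have Dw : diag_mx d *m w = w.
    rewrite /w -{2}Mv map_mxM -/(complexify M) Md !mulmxA mulmxV //.
    by rewrite mul1mx.
  have /existsP[i wi] : [exists i, w i 0 != 0].
    apply: contraNT w0; rewrite negb_exists => /forallP w0.
    by apply/eqP/colP => i; have := w0 i; rewrite negbK [RHS]mxE => /eqP.
  apply/mapP; exists i; first by rewrite mem_enum.
  have /colP/(_ i) := Dw; rewrite mul_diag_mx [LHS]mxE => /eqP.
  by rewrite -{2}[w i 0]mul1r (inj_eq (mulIf wi)) => /eqP.
- by rewrite -(det_conj_diag _ _ P) // -Md det_map_mx detM rmorph1.
- rewrite -(trace_conj_diag _ _ P) // -Md trace_map_mx -(lorentz_trmxV _ hM).
  rewrite -trace_map_mx -/(complexify _) MVd trace_conj_diag // !big_map.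
  by apply: eq_bigr => i _; rewrite mxE.
exists x, P, d; split=> //.
have /mapP[i _ ->] : x \in [seq d 0 i | i <- enum 'I_4].
  by rewrite (perm_mem hx) !inE eqxx !orbT.
exact: dn0.
Qed.

End Spectrum.

(** * Modulus of the remaining eigenvalue, and powers of a diagonalised transformation *)

Section Fix.
Variable R : realType.
Implicit Types (M : 'M[R]_4).

Lemma normc1 (x : R[i]) : complex.Re x ^+ 2 + complex.Im x ^+ 2 = 1 -> `|x| = 1.
Proof. by rewrite normc_def => ->; rewrite sqrtr1. Qed.

(** A real matrix commutes with real and imaginary parts, so the real form can be applied to the two
    parts of a complex eigenvector. *)
Lemma eigenvector_ReIm M (w : 'cV[R[i]]_4) (x : R[i]) :
  complexify M *m w = x *: w ->
  let a := map_mx (@complex.Re R) w in let b := map_mx (@complex.Im R) w in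
  M *m a = complex.Re x *: a - complex.Im x *: b /\
  M *m b = complex.Im x *: a + complex.Re x *: b.
Proof.
move=> Mw /=; split; apply/colP => i; have /colP/(_ i) := Mw; rewrite !mxE.
  move/(congr1 (@complex.Re R)); rewrite raddf_sum /= => E.
  transitivity (complex.Re (x * w i 0)).
    by rewrite -E; apply: eq_bigr => j _; rewrite !mxE; case: (w j 0) =>
      u v /=; ring.
  by case: (x) (w i 0) => ? ? [].
move/(congr1 (@complex.Im R)); rewrite raddf_sum /= => E.
transitivity (complex.Im (x * w i 0)).
  by rewrite -E; apply: eq_bigr => j _; rewrite !mxE; case: (w j 0) => u v /=;
    ring.
by case: (x) (w i 0) => ? ? [] ? ? /=; ring.
Qed.

Lemma ReIm_eq0 n (w : 'cV[R[i]]_n) : map_mx (@complex.Re R) w = 0 ->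
  map_mx (@complex.Im R) w = 0 -> w = 0.
Proof.
move=> re im; apply/colP => i; move/colP/(_ i): re; move/colP/(_ i): im.
by rewrite !mxE; case: (w i 0) => u v /= -> ->.
Qed.

(* On the orthogonal complement of a fixed lightlike pair the form is positive
   definite, so the Hermitian norm of an eigenvector pins down the modulus. *)
Lemma lorentz_fix2_norm1 M (x1 x2 : 'cV[R]_4) (w : 'cV[R[i]]_4) (x : R[i]) :
  lorentz _ M -> mink x1 x1 = 0 -> mink x2 x2 = 0 -> mink x1 x2 != 0 ->
  M *m x1 = x1 -> M *m x2 = x2 ->
  w != 0 -> complexify M *m w = x *: w -> `|x| = 1.
Proof.
move=> hM x11 x22 x12 M1 M2 w0 Mw.
have [->|x1n] := eqVneq x 1; first by rewrite normr1.
have [] := eigenvector_ReIm _ _ _ Mw.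
set a := map_mx _ w; set b := map_mx _ w.
set u := complex.Re x; set v := complex.Im x => Ma Mb.
have uv : (u - 1) ^+ 2 + v ^+ 2 != 0.
  apply: contra x1n; rewrite paddr_eq0 ?sqr_ge0 // !sqrf_eq0 subr_eq0.
  by rewrite /u /v; case: (x) => ? ? /= /andP[/eqP -> /eqP ->].
(* Pairing a fixed [y] with [a] and [b] gives a homogeneous 2 by 2 system whose determinant is |x -
   1|^2, nonzero by [uv]. *)
have ortho y : M *m y = y -> mink y a = 0 /\ mink y b = 0.
  move=> My.
  have A : mink y a = u * mink y a - v * mink y b.
    by rewrite -{1}hM My Ma minkDr -scaleNr !minkZr mulNr.
  have B : mink y b = v * mink y a + u * mink y b.
    by rewrite -{1}hM My Mb minkDr !minkZr.
  split; apply/eqP; apply: contraTT uv => n0;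
    rewrite negbK -(mulrI_eq0 _ (mulfI n0)); apply/eqP.
    transitivity ((u - 1) * (u * mink y a - v * mink y b - mink y a)
       + v * (v * mink y a + u * mink y b - mink y b)); first by ring.
    by rewrite -A -B; ring.
  transitivity (- v * (u * mink y a - v * mink y b - mink y a)
       + (u - 1) * (v * mink y a + u * mink y b - mink y b)); first by ring.
  by rewrite -A -B; ring.
have [a1 b1] := ortho _ M1; have [a2 b2] := ortho _ M2.
have [aa aa0] := lightlike_pair_ortho _ _ _ _ x11 x22 x12 a1 a2.
have [bb bb0] := lightlike_pair_ortho _ _ _ _ x11 x22 x12 b1 b2.
have N0 : mink a a + mink b b != 0.
  apply: contra w0; rewrite paddr_eq0 // => /andP[/eqP/aa0 a0 /eqP/bb0 b0].
  by apply/eqP/ReIm_eq0.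
(* Invariance of the form multiplies the positive number (a,a) + (b,b) by |x|^2, and leaves it
   unchanged. *)
apply: normc1; rewrite -/u -/v; apply: (mulIf N0); rewrite mul1r.
rewrite -[in RHS](hM a a) -[in RHS](hM b b) Ma Mb -!scaleNr.
rewrite !minkDl !minkDr !minkZl !minkZr (minkC _ b a).
by ring.
Qed.

Lemma conj_diag_pow (F : fieldType) n (P : 'M[F]_n.+1) (d : 'rV_n.+1) l :
  P \in unitmx -> (forall i, d 0 i ^+ l = 1) ->
  (invmx P *m diag_mx d *m P) ^+ l = 1.
Proof.
move=> uP dl.
have -> : (invmx P *m diag_mx d *m P) ^+ l = invmx P *m diag_mx
  (map_mx (fun z => z ^+ l) d) *m P.
  elim: l {dl} => [|l IH].
    rewrite expr0 (_ : map_mx _ _ = const_mx 1); last by apply/rowP => i;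
      rewrite !mxE.
    by rewrite diag_const_mx mulmx1 mulVmx.
  rewrite exprS IH -[_ * _]/(_ *m _) !mulmxA (mulmxK uP) -(mulmxA (invmx P))
    mulmx_diag.
  by congr (_ *m diag_mx _ *m _); apply/rowP => i; rewrite !mxE exprS.
rewrite (_ : map_mx _ _ = const_mx 1); last by apply/rowP => i; rewrite !mxE.
by rewrite diag_const_mx mulmx1 mulVmx.
Qed.

Lemma complexify_inj : injective (@complexify R).
Proof. exact: map_mx_inj. Qed.

Section Diagonalised.
Variables (M : 'M[R]_4) (x : R[i]) (P : 'M[R[i]]_4) (d : 'rV[R[i]]_4).
Hypotheses (uP : P \in unitmx) (Md : complexify M = invmx P *m diag_mx d *m P)
  (dE : perm_eq [seq d 0 i | i <- enum 'I_4] [:: 1; 1; x; x^-1]).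

Lemma lorentz_spectrum_trace : (\tr M)%:C%C = 2 + (x + x^-1).
Proof.
rewrite -trace_map_mx -/(complexify M) Md trace_conj_diag // (perm_big _ dE) /=.
by rewrite !big_cons big_nil addr0 addrA.
Qed.

Lemma lorentz_spectrum_pow l : x ^+ l = 1 -> M ^+ l = 1.
Proof.
move=> xl; apply: complexify_inj.
have -> : complexify (M ^+ l) = complexify M ^+ l.
  by rewrite /complexify rmorphXn.
rewrite Md [complexify 1]map_mx1 conj_diag_pow // => i.
have : d 0 i \in [:: 1; 1; x; x^-1].
  by rewrite -(perm_mem dE); apply: map_f; rewrite mem_enum.
by rewrite !inE => /or4P[] /eqP ->; rewrite ?expr1n ?exprVn ?xl ?invr1.
Qed.

Lemma lorentz_spectrum_eigenvector :
  exists2 w : 'cV[R[i]]_4, w != 0 & complexify M *m w = x *: w.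
Proof.
have /mapP[i _ di] : x \in [seq d 0 i | i <- enum 'I_4].
  by rewrite (perm_mem dE) !inE eqxx !orbT.
exists (invmx P *m delta_mx i 0).
  apply/eqP => /(congr1 (mulmx P)); rewrite mulKVmx // mulmx0 => /colP/(_ i).
  by rewrite !mxE !eqxx => /eqP; rewrite oner_eq0.
rewrite Md -!mulmxA mulKVmx // scalemxAr; congr (_ *m _).
apply/colP => j; rewrite mul_diag_mx !mxE di.
by case: eqVneq => [->|]; rewrite //= !mulr0.
Qed.

(** On the unit circle the inverse of [x] is its conjugate. *)
Lemma lorentz_spectrum_eigenvalue : `|x| = 1 ->
  forall a, eigenvalue (complexify M) a = (a \in [:: 1; x; x^*]).
Proof.
move=> x1 a; rewrite Md eigenvalue_diag // (perm_mem dE).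
by rewrite invC_norm x1 expr1n invr1 mul1r !inE orbA orbb.
Qed.

End Diagonalised.
End Fix.

(** * Roots of unity *)
Section Unity.
Variable R : realType.
Local Open Scope classical_set_scope.

Lemma de_moivre (t : R) n :
  (cos t +i* sin t)%C ^+ n = (cos (n%:R * t) +i* sin (n%:R * t))%C.
Proof.
elim: n => [|n IH]; first by rewrite expr0 mul0r cos0 sin0.
rewrite exprS IH -natr1 mulrDl mul1r (addrC _ t) cosD sinD.
by apply/eqP; rewrite eq_complex /= eqxx /=; apply/eqP; ring.
Qed.

(** With t = 2 pi / n, the hypothesis makes [x] a root of z^2 - 2 cos(t) z + 1, whose roots are
    exp(it) and exp(-it). *)
Lemma root_of_unity_trace (x : R[i]) (n : nat) : x != 0 -> (0 < n)%N ->
  x + x^-1 = (2 * cos (2 * pi / n%:R))%:C%C -> x ^+ n = 1.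
Proof.
move=> x0 n0; set t := 2 * pi / _ => xt.
have nt : n%:R * t = pi *+ 2.
  by rewrite /t mulrC divfK ?pnatr_eq0 -?lt0n // mulr_natl.
have e1 : (cos t +i* sin t)%C ^+ n = 1.
  by rewrite de_moivre nt cos2pi sin2pi.
have e2 : (cos (- t) +i* sin (- t))%C ^+ n = 1.
  by rewrite de_moivre mulrN nt cosN sinN cos2pi sin2pi oppr0.
have : (x - (cos t +i* sin t)%C) * (x - (cos (- t) +i* sin (- t))%C) = 0.
  have sE : (cos t +i* sin t)%C + (cos (- t) +i* sin (- t))%C = x + x^-1.
    rewrite xt cosN sinN; apply/eqP; rewrite eq_complex /= subrr eqxx andbT.
    by apply/eqP; ring.
  have pE : (cos t +i* sin t)%C * (cos (- t) +i* sin (- t))%C = 1.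
    rewrite cosN sinN; apply/eqP; rewrite eq_complex /=; apply/andP; split;
      apply/eqP.
      by rewrite mulrN opprK -!expr2 cos2Dsin2.
    by ring.
  transitivity (x * x -
    x * ((cos t +i* sin t)%C + (cos (- t) +i* sin (- t))%C) +
    (cos t +i* sin t)%C * (cos (- t) +i* sin (- t))%C); first by ring.
  by rewrite sE pE; field.
move/eqP; rewrite mulf_eq0 !subr_eq0 => /orP[] /eqP -> //.
Qed.

(** The shift by 2 keeps the angle in [0, pi], where the cosine is injective. *)
Lemma cos_two_pi_div_inj : injective (fun n => cos (2 * pi / n.+2%:R) : R).
Proof.
move=> n k /cos_inj.
have itv j : 2 * pi / j.+2%:R \in `[0, pi : R]%R.
  rewrite in_itv /= divr_ge0 ?mulr_ge0 ?pi_ge0 //=.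
  by rewrite ler_pdivrMr ?ltr0n // mulrC ler_wpM2l ?pi_ge0 // ler_nat.
move=> /(_ (itv n) (itv k)).
have pi0 : 2 * pi != 0 :> R by rewrite mulf_neq0 ?pnatr_eq0 // gt_eqF ?pi_gt0.
by move=> /(mulfI pi0)/invr_inj/eqP; rewrite eqr_nat => /eqP[].
Qed.

Lemma cos_two_pi_div_near1 (c : R) : c < 1 ->
  exists N, forall n, (N <= n)%N -> c < cos (2 * pi / n.+2%:R).
Proof.
move=> c1.
have /cvgrPdist_lt/(_ (1 - c)) := @continuous_cos R 0.
rewrite cos0 subr_gt0 => /(_ c1)/nbhs_ballP[d /= d0 hd].
pose N := Num.truncn (d^-1 * (2 * pi)).
exists N => n Nn.
have /hd /= : ball (0 : R) d (2 * pi / n.+2%:R).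
  rewrite /ball /= sub0r normrN ger0_norm ?divr_ge0 ?mulr_ge0 ?pi_ge0 //.
  rewrite ltr_pdivrMr ?ltr0n // -ltr_pdivrMl //.
  apply: lt_le_trans (truncnS_gt _) _.
  by rewrite ler_nat (leq_trans _ (leqnSn _)).
by have := cos_le1 (2 * pi / n.+2%:R : R); rewrite ltr_norml => ? /andP[]; lra.
Qed.

(** Among the first [size B + size P] values of [f], at most [size B] lie in [B] and fewer than
    [size P] are roots of [P]. It serves to avoid the non-diagonalisable parameters and the zeros of
    the conserved quantity at once. *)
Lemma injection_avoids (F : idomainType) (f : nat -> F) (B : seq F)
    (P : {poly F}) :
  injective f -> P != 0 -> exists n, f n \notin B /\ ~~ root P (f n).
Proof.
move=> inj_f P0; apply: contrapT => nex.
have bad n : f n \notin B -> root P (f n).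
  by move=> nB; apply: contraPT nex => nr; apply; exists n.
pose l := [seq f n | n <- iota 0 (size B + size P)].
have ul : uniq l by rewrite map_inj_uniq ?iota_uniq.
pose l' := [seq x <- l | x \notin B].
have : (size l' < size P)%N.
  apply: max_poly_roots => //; last exact: filter_uniq.
  by apply/allP => x; rewrite mem_filter => /andP[xB /mapP[n _ xE]];
    rewrite xE bad // -xE.
have : (size [seq x <- l | x \in B] <= size B)%N.
  by apply: uniq_leq_size; [exact: filter_uniq|move=> x; rewrite mem_filter =>
    /andP[]].
have : (size [seq x <- l | x \in B] + size l' = size B + size P)%N.
  by rewrite !size_filter count_predC size_map size_iota.
by move=> E aB l'P; have := leq_add aB l'P; rewrite addnS E ltnn.
Qed.

End Unity.

(** * Derivatives of matrix-valued curves *)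
Section Deriv.
Variable R : realType.

Lemma is_derive_continuous (f : R -> R) (df : R -> R) :
  (forall s, is_derive s (1 : R) f (df s)) -> continuous f.
Proof.
by move=> h s; apply: differentiable_continuous; apply/derivable1_diffP;
  case: (h s).
Qed.

Lemma is_derive_mulr (f g : R -> R) (df dg s : R) :
  is_derive s (1 : R) f df -> is_derive s (1 : R) g dg ->
  is_derive s (1 : R) (fun t => f t * g t) (df * g s + f s * dg).
Proof.
move=> hf hg; have := is_deriveM hf hg.
by rewrite addrC [g s *: df]mulrC.
Qed.

Lemma is_derive_sumr n (f : 'I_n -> R -> R) (df : 'I_n -> R) (s : R) :
  (forall i, is_derive s (1 : R) (f i) (df i)) ->
  is_derive s (1 : R) (fun t => \sum_i f i t) (\sum_i df i).
Proof.
move=> h; rewrite (_ : (fun t => _) = \sum_i f i); first exact: is_derive_sum.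
by apply/funext => t; rewrite fct_sumE.
Qed.

Lemma is_derive_coord m n (Y : R -> 'M[R]_(m.+1, n.+1)) Y' (s : R) i j :
  is_derive s (1 : R) Y Y' -> is_derive s (1 : R)
    (fun t => Y t i j : R) (Y' i j).
Proof.
case=> dY vY; split; first exact: (derivable_mxP Y s 1).1.
by rewrite -vY derive_mx // mxE.
Qed.

Lemma is_derive_mx m n (Y : R -> 'M[R]_(m.+1, n.+1))
    (Y' : 'M[R]_(m.+1, n.+1)) (s : R) :
  (forall i j, is_derive s (1 : R) (fun t => Y t i j : R) (Y' i j)) ->
  is_derive s (1 : R) Y Y'.
Proof.
move=> h; have dY : derivable Y s 1.
  by apply/derivable_mxP => i j; case: (h i j).
split=> //; rewrite derive_mx //; apply/matrixP => i j; rewrite mxE.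
by case: (h i j).
Qed.

Lemma is_derive_mulmx m n p (Y : R -> 'M[R]_(m.+1, n.+1))
    (Z : R -> 'M[R]_(n.+1, p.+1)) Y' Z' (s : R) :
  is_derive s (1 : R) Y Y' -> is_derive s (1 : R) Z Z' ->
  is_derive s (1 : R) (fun t => Y t *m Z t) (Y' *m Z s + Y s *m Z').
Proof.
move=> hY hZ; apply: is_derive_mx => i j.
rewrite (_ : (fun t => _) = (fun t => \sum_k Y t i k * Z t k j)); last first.
  by apply/funext => t; rewrite mxE.
rewrite !mxE -big_split /=; apply: is_derive_sumr => k.
have hy := @is_derive_coord _ _ _ _ _ i k hY.
have hz := @is_derive_coord _ _ _ _ _ k j hZ.
exact: is_derive_mulr.
Qed.

Lemma is_derive_trmx m n (Y : R -> 'M[R]_(m.+1, n.+1))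
    (Y' : 'M[R]_(m.+1, n.+1)) (s : R) :
  is_derive s (1 : R) Y Y' -> is_derive s (1 : R) (fun t => (Y t)^T) Y'^T.
Proof.
move=> hY; apply: is_derive_mx => i j.
rewrite (_ : (fun t => _) = (fun t => Y t j i)); last first.
  by apply/funext => t; rewrite mxE.
by rewrite mxE; apply: is_derive_coord.
Qed.

(** A general matrix [E] covers both the Minkowski form and the Euclidean norm [sqnorm]. *)
Lemma is_derive_bilinear (E : 'M[R]_4) (Y Z : R -> 'cV[R]_4) Y' Z' (s : R) :
  is_derive s (1 : R) Y Y' -> is_derive s (1 : R) Z Z' ->
  is_derive s (1 : R) (fun t => ((Y t)^T *m E *m Z t) 0 0 : R)
    ((Y'^T *m E *m Z s) 0 0 + ((Y s)^T *m E *m Z') 0 0).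
Proof.
move=> hY hZ.
have hYE : is_derive s (1 : R) (fun t => (Y t)^T *m E) (Y'^T *m E).
  have := is_derive_mulmx _ _ _ _ (cst E) _ _ _ (is_derive_trmx _ _ _ _ _ hY)
    (is_derive_cst _ _ _).
  by rewrite mulmx0 addr0.
have := is_derive_coord _ _ _ _ _ 0 0 (is_derive_mulmx _ _ _ _ _ _ _ _ hYE hZ).
by rewrite [X in is_derive _ _ _ X]mxE.
Qed.

Lemma is_derive_mink (Y Z : R -> 'cV[R]_4) Y' Z' (s : R) :
  is_derive s (1 : R) Y Y' -> is_derive s (1 : R) Z Z' ->
  is_derive s (1 : R) (fun t => mink (Y t) (Z t))
    (mink Y' (Z s) + mink (Y s) Z').
Proof. exact: is_derive_bilinear. Qed.

Lemma is_derive_mulmxr (Y : R -> 'M[R]_4) (w : 'cV[R]_4) Y' (s : R) :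
  is_derive s (1 : R) Y Y' ->
  is_derive s (1 : R) (fun t => Y t *m w) (Y' *m w).
Proof.
move=> hY; have := is_derive_mulmx _ _ _ _ (cst w) _ _ _ hY (is_derive_cst _ _
  _).
by rewrite mulmx0 addr0.
Qed.

(** Growth estimates need a definite form. The identity matrix is kept in the product so that
    [is_derive_bilinear] and [bilinear_bound] apply directly. *)
Definition sqnorm (y : 'cV[R]_4) : R := (y^T *m 1%:M *m y) 0 0.

Lemma sqnormE y : sqnorm y = \sum_i y i 0 ^+ 2.
Proof. by rewrite /sqnorm mulmx1 mxE; apply: eq_bigr => i _; rewrite mxE. Qed.

Lemma sqnorm_ge0 y : 0 <= sqnorm y.
Proof. by rewrite sqnormE; apply: sumr_ge0 => i _; apply: sqr_ge0. Qed.

(** Each term is at most C/2 times the sum of two squares, and each square occurs four times, whence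
    the factor 2. *)
Lemma bilinear_bound (E : 'M[R]_4) (C : R) (y z : 'cV[R]_4) :
  (forall i j, `|E i j| <= C) ->
  `|(y^T *m E *m z) 0 0| <= 2 * C * (sqnorm y + sqnorm z).
Proof.
move=> hE.
have -> : 2 * C * (sqnorm y + sqnorm z) =
    \sum_(i < 4) \sum_(j < 4) (2^-1 * C * (y j 0 ^+ 2 + z i 0 ^+ 2)).
  transitivity (\sum_(i < 4) (2^-1 * C * (sqnorm y + z i 0 ^+ 2 *+ 4))).
    rewrite -mulr_sumr big_split /= sumr_const card_ord sumrMnl -sqnormE.
    by rewrite -(mulr_natr (sqnorm y)) -(mulr_natr (sqnorm z)); field.
  by apply: eq_bigr => i _; rewrite -mulr_sumr big_split /= sumr_const card_ord
    sqnormE.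
rewrite mxE (le_trans (ler_norm_sum _ _ _)) // ler_sum // => i _.
rewrite mxE mulr_suml (le_trans (ler_norm_sum _ _ _)) // ler_sum // => j _.
rewrite mxE !normrM -(real_normK (num_real (y j 0))) -(real_normK (num_real (z
  i 0))).
have C0 : 0 <= C by apply: le_trans (hE 0 0).
apply: (@le_trans _ _ (C * (`|y j 0| * `|z i 0|))).
  by rewrite (mulrC `|y j 0|) -mulrA; apply: ler_wpM2r; rewrite ?mulr_ge0.
have yz : `|y j 0| * `|z i 0| <= 2^-1 * (`|y j 0| ^+ 2 + `|z i 0| ^+ 2).
  by have := sqr_ge0 (`|y j 0| - `|z i 0|); nra.
by rewrite (mulrC 2^-1) -mulrA ler_wpM2l.
Qed.

End Deriv.

(** * Dependence of parallel sections on the spectral parameter *)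
Section Curve.
Variable R : realType.
Local Open Scope classical_set_scope.

Lemma smooth_is_derive (V : normedModType R) (f : R -> V) s :
  smooth f -> is_derive s (1 : R) f (derive1 f s).
Proof. by move=> sf; rewrite derive1E; apply/derivableP/(sf 0%N). Qed.

Lemma smooth_derive1_is_derive (V : normedModType R) (f : R -> V) s :
  smooth f -> is_derive s (1 : R) (derive1 f) (derive1 (derive1 f) s).
Proof. by move=> sf; rewrite derive1E; apply/derivableP/(sf 1%N). Qed.

(** Unlike [parallel], which uses the total function [derive1], this includes differentiability. *)
Definition flow (m : R -> R) (X : R -> 'cV[R]_4) (nu : R) (Y : R -> 'cV[R]_4) :=
  forall s : R, is_derive s (1 : R) Y (- nu *: (eta m X s *m Y s)).

Section Polarised.
Variables (m : R -> R) (L : R -> {vspace 'cV[R]_4}) (X : R -> 'cV[R]_4).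
Hypothesis hL : polarised_curve m L X.

(** Differentiating (X,X) = 0 shows that X' is orthogonal to X; were X' also null, it would lie on
    the line of X, against regularity. *)
Lemma mink_derive1_neq0 s : mink (derive1 X s) (derive1 X s) != 0.
Proof.
have [_ [sX XL] llX X'L] := hL.
have XX t : mink (X t) (X t) = 0.
  by apply: (llX t); rewrite (XL t).2 memv_line.
have XX' : mink (X s) (derive1 X s) = 0.
  have hX := smooth_is_derive _ _ s sX.
  have := is_derive_mink _ _ _ _ _ _ hX hX.
  rewrite (_ : (fun t => _) = cst 0); last by apply/funext => t; rewrite XX.
  case=> _; rewrite derive_cst (minkC _ (X s)) => E; lra.
apply: contra (X'L s) => /eqP X'X'; rewrite (XL s).2.
by apply: lightlike_ortho => //; case: (XL s).
Qed.

Lemma eta_coordE s i j : eta m X s i j =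
  (m s)^-1 * (mink (derive1 X s) (derive1 X s))^-1 *
  ((derive1 X s i 0 * X s j 0 - X s i 0 * derive1 X s j 0) * mink_mx R j j).
Proof.
rewrite /eta /wedge mxE /mink_mx mul_mx_diag !mxE !big_ord1 !mxE.
by rewrite eqxx mulr1n.
Qed.

Lemma eta_coord_continuous i j : continuous (fun s => eta m X s i j : R).
Proof.
have [[sm m0] [sX XL] llX X'L] := hL.
have cX k : continuous (fun s => X s k 0 : R).
  by apply: is_derive_continuous => s; apply: is_derive_coord;
    apply: smooth_is_derive.
have cX' k : continuous (fun s => derive1 X s k 0 : R).
  by apply: is_derive_continuous => s; apply: is_derive_coord;
    apply: smooth_derive1_is_derive.
have cm : continuous m.
  by apply: is_derive_continuous => s; apply: (smooth_is_derive _ (m : R ->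
    R^o)).
have cX'X' : continuous (fun s => mink (derive1 X s) (derive1 X s)).
  by apply: is_derive_continuous => s; apply: is_derive_mink;
    apply: smooth_derive1_is_derive.
rewrite (_ : (fun s => _) = (fun s =>
  (m s)^-1 * (mink (derive1 X s) (derive1 X s))^-1 *
  ((derive1 X s i 0 * X s j 0 - X s i 0 * derive1 X s j 0) * mink_mx R j j)));
    last first.
  by apply/funext => s; rewrite eta_coordE.
move=> s; apply: cvgM.
  by apply: cvgM; apply: cvgV; rewrite ?mink_derive1_neq0 //;
    [exact: cm|exact: cX'X'].
apply: cvgM; last exact: cvg_cst.
by apply: cvgB; apply: cvgM; by [exact: cX|exact: cX'].
Qed.

(** Compactness of [0, T], applied to the sum of the absolute values of all entries so that one
    constant serves them all. *)
Lemma eta_bounded T : 0 <= T ->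
  exists C : R, forall s : R, 0 <= s <= T -> forall i j, `|eta m X s i j| <= C.
Proof.
move=> T0; pose F s := \sum_i \sum_j `|eta m X s i j|.
have cF : {within `[0, T], continuous F}.
  apply: continuous_subspaceT => s.
  apply: cvg_big => // [|i _]; first exact: add_continuous.
  apply: cvg_big => // [|j _]; first exact: add_continuous.
  by apply: cvg_norm; exact: eta_coord_continuous.
have [c _ Fc] := EVT_max T0 cF; exists (F c) => s sT i j.
apply: le_trans (Fc s _); last by rewrite in_itv.
rewrite /F (bigD1 i) //= (bigD1 j) //= -addrA lerDl.
by rewrite addr_ge0 ?sumr_ge0 // => k _; rewrite sumr_ge0.
Qed.

(** Skewness of [eta] merges the two terms into one with factor nu - nu'. Equal parameters give
    conservation; different ones give the Lipschitz estimate in the parameter. *)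
Lemma flow_mink nu nu' Y Z s : flow m X nu Y -> flow m X nu' Z ->
  is_derive s (1 : R) (fun t => mink (Y t) (Z t))
    ((nu - nu') * mink (Y s) (eta m X s *m Z s)).
Proof.
move=> hY hZ; apply: is_derive_eq; first exact: is_derive_mink (hY s) (hZ s).
rewrite minkZl minkZr /eta -!scalemxAl minkZl minkZr wedge_skew.
by ring.
Qed.

Lemma flow_mink_cst nu Y Z s : flow m X nu Y -> flow m X nu Z ->
  mink (Y s) (Z s) = mink (Y 0) (Z 0).
Proof.
move=> hY hZ; apply: (@is_derive_0_is_cst _ (fun t => mink (Y t) (Z t))) => t.
by apply: is_derive_eq; [exact: flow_mink hY hZ|rewrite subrr mul0r].
Qed.

Lemma flow_sqnorm nu Z s : flow m X nu Z ->
  is_derive s (1 : R) (fun t => sqnorm _ (Z t))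
    (- nu * (2 * ((Z s)^T *m eta m X s *m Z s) 0 0)).
Proof.
move=> hZ.
apply: is_derive_eq; first exact: (is_derive_bilinear _ _ _ _ _ _ _ (hZ s) (hZ
  s)).
have tr : ((eta m X s *m Z s)^T *m Z s) 0 0 = ((Z s)^T *m eta m X s *m Z s) 0 0.
  rewrite -[LHS]trace_mx11 -mxtrace_tr trace_mx11 trmx_mul trmxK.
  by rewrite mulmxA.
rewrite !mulmx1 linearZ /= -scalemxAl -scalemxAr [X in X + _]mxE [X in _ +
  X]mxE tr.
by rewrite mulmxA -mulrDr -mulr2n [in RHS]mulr_natl.
Qed.

(** * Growth estimates on a period *)

Section Growth.
Variables (T C N : R).
Hypotheses (T0 : 0 <= T) (N0 : 0 <= N)
  (etaC : forall s : R, 0 <= s <= T -> forall i j, `|eta m X s i j| <= C).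

Lemma bound_ge0 : 0 <= C.
Proof. by apply: le_trans (etaC 0 _ 0 0); rewrite // lexx. Qed.

(* Gronwall's inequality. *)
Lemma flow_growth nu Z (s : R) : flow m X nu Z -> `|nu| <= N -> 0 <= s <= T ->
  sqnorm _ (Z s) <= sqnorm _ (Z 0) * expR (8 * N * C * T).
Proof.
(* The derivative of [sqnorm] along [Z] is at most N * 2 * (2 * C * 2) times [sqnorm], so K = 8NC
   makes [f] nonincreasing. *)
move=> hZ nuN /andP[s0 sT]; pose K := 8 * N * C.
have K0 : 0 <= K by rewrite !mulr_ge0 // bound_ge0.
pose f t := sqnorm _ (Z t) * expR (- K * t).
pose df t := (- nu * (2 * ((Z t)^T *m eta m X t *m Z t) 0 0) -
  K * sqnorm _ (Z t)) * expR (- K * t).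
have hf t : is_derive t (1 : R) f (df t).
  have hl : is_derive t (1 : R) (fun u => - K * u) (- K).
    have := is_derive_mulr _ _ _ _ _ _ (is_derive_cst (- K) t 1) (is_derive_id
      t (1 : R)).
    by rewrite mul0r add0r mulr1.
  have he : is_derive t (1 : R) (fun u =>
    expR (- K * u)) (expR (- K * t) * - K).
    exact: (is_derive1_comp (is_derive_expR (- K * t)) hl).
  apply: is_derive_eq; first exact: is_derive_mulr _ _ _ _ _ _ (flow_sqnorm _ _
    _ hZ) he.
  by rewrite /df; ring.
have df0 t : 0 <= t <= T -> df t <= 0.
  move=> tT; rewrite /df mulr_le0_ge0 ?expR_ge0 // subr_le0.
  rewrite (le_trans (ler_norm _)) // normrM normrN.
  have := bilinear_bound _ _ _ (Z t) (Z t) (etaC t tT).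
  rewrite normrM (ger0_norm (_ : 0 <= 2)) // /K => bb.
  apply: (@le_trans _ _ (N * (2 * (2 * C * (sqnorm _ (Z t) + sqnorm _ (Z
    t)))))).
    by apply: ler_pM => //; [rewrite mulr_ge0|rewrite ler_wpM2l].
  by rewrite le_eqVlt; apply/orP; left; apply/eqP; ring.
have : f s <= f 0.
  apply: (@ler0_derive1_le_cc _ f 0 T) => //; rewrite ?in_itv /= ?lexx ?s0 //.
  - move=> t; rewrite in_itv /= => /andP[/ltW t0 /ltW tT].
    by rewrite derive1E; case: (hf t) => _ ->; rewrite df0 // t0.
  - by apply: continuous_subspaceT; apply: is_derive_continuous hf.
rewrite /f mulr0 expR0 mulr1 mulNr expRN ler_pdivrMr ?expR_gt0 // => /le_trans;
  apply.
by rewrite ler_wpM2l ?sqnorm_ge0 // ler_expR ler_wpM2l.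
Qed.

(** The mean value theorem on [0, T] extracts the factor nu - nu' from [flow_mink]; the remaining
    pairing is controlled by [flow_growth]. *)
Lemma flow_mink_lipschitz nu nu' Y Z : flow m X nu Y -> flow m X nu' Z ->
  `|nu| <= N -> `|nu'| <= N ->
  `|mink (Y T) (Z T) - mink (Y 0) (Z 0)| <=
   `|nu - nu'| * (2 * C * ((sqnorm _ (Y 0) + sqnorm _ (Z 0))
     * expR (8 * N * C * T)) * T).
Proof.
move=> hY hZ nuN nu'N.
have [||c] := @MVT_segment _ (fun t => mink (Y t) (Z t))
  (fun s => (nu - nu') * mink (Y s) (eta m X s *m Z s)) 0 T T0.
- by move=> t _; apply: flow_mink.
- apply: continuous_subspaceT; apply: is_derive_continuous => t.
  exact: flow_mink hY hZ.
rewrite in_itv /= => cT ->; rewrite subr0 !normrM -mulrA ler_wpM2l //.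
rewrite (ger0_norm T0) ler_wpM2r // mink_mulmxr.
have JC i j : `|(mink_mx R *m eta m X c) i j| <= C.
  rewrite /mink_mx mul_diag_mx mxE [X in `|X * _|]mxE normrM.
  by case: ifP => _; rewrite ?normrN normr1 mul1r etaC.
apply: le_trans (bilinear_bound _ _ _ _ _ JC) _.
rewrite ler_wpM2l ?mulr_ge0 ?bound_ge0 // mulrDl lerD //.
  by apply: flow_growth hY _ _.
by apply: flow_growth hZ _ _.
Qed.

End Growth.
End Polarised.
End Curve.

(** * Monodromy *)
Section Monodromy.
Variable R : realType.
Local Open Scope classical_set_scope.

Lemma lipschitz_at_continuous (f : R -> R) (x K : R) :
  (forall y, `|x - y| <= 1 -> `|f x - f y| <= `|x - y| * K) ->
  f y @[y --> x] --> f x.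
Proof.
move=> hf; apply/cvgrPdist_lt => e e0.
(* The sign of [K] is unknown; [|K| + 1] is a positive constant that can be divided by. *)
have K0 : 0 < `|K| + 1 by rewrite ltr_pwDr.
near=> y.
apply: (@le_lt_trans _ _ (`|x - y| * (`|K| + 1))).
  apply: le_trans (hf y _) _.
    by apply: ltW; near: y; apply: (nbhsx_ballx x 1).
  by rewrite ler_wpM2l // (le_trans (ler_norm _)) // lerDl.
rewrite -ltr_pdivlMr //; near: y.
by apply: (nbhsx_ballx x (e / (`|K| + 1))); rewrite divr_gt0.
Unshelve. all: by end_near. Qed.

(** Transfers continuity from Minkowski pairings to matrix entries; the sign squares to 1. *)
Lemma mx_coord_mink (M : 'M[R]_4) i j :
  M i j = mink_mx R i i * mink (delta_mx i 0) (M *m delta_mx j 0).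
Proof.
have JE : mink_mx R i i = if i == ord0 then -1 else 1.
  by rewrite /mink_mx mxE eqxx mulr1n mxE.
have -> : mink (delta_mx i 0) (M *m delta_mx j 0) = mink_mx R i i * M i j.
  rewrite /mink trmx_delta -mulmxA -rowE mxE mulmxA -colE mxE.
  by rewrite {1}/mink_mx mul_diag_mx mxE JE [X in X * _]mxE.
by rewrite JE; case: ifP => _; rewrite mulrA ?mulrNN mul1r mul1r.
Qed.

Variables (m : R -> R) (L : R -> {vspace 'cV[R]_4}) (X : R -> 'cV[R]_4)
  (A : R -> R -> 'M[R]_4).
Hypotheses (hL : polarised_curve m L X) (hA : parallel_frames m X A).

Lemma parallel_flow nu Y : parallel m X nu Y ->
  (forall s, derivable Y s 1) -> flow _ m X nu Y.
Proof.
move=> hY dY s; split; first exact: dY.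
by rewrite -derive1E scaleNr; apply/eqP; rewrite -addr_eq0 hY.
Qed.

Lemma frame_flow nu (w : 'cV[R]_4) : flow _ m X nu (fun s => A nu s *m w).
Proof.
move=> s; have [_ hAs] := hA nu.
apply: is_derive_eq; first exact: is_derive_mulmxr (hAs s).
by rewrite -scalemxAl mulmxA.
Qed.

Lemma frame0 nu (w : 'cV[R]_4) : A nu 0 *m w = w.
Proof. by rewrite (hA nu).1 mul1mx. Qed.

Lemma frame_lorentz nu s : lorentz _ (A nu s).
Proof.
move=> x y; rewrite (flow_mink_cst _ _ _ _ _ _ _ (frame_flow nu x) (frame_flow
  nu y)).
by rewrite !frame0.
Qed.

Lemma lorentz_det (M : 'M[R]_4) : lorentz _ M -> \det M = 1 \/ \det M = -1.
Proof.
move=> hM; have := congr1 determinant (lorentz_mxP _ _ hM).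
rewrite !det_mulmx det_tr => E.
have J0 : \det (mink_mx R) != 0.
  have /mulmx1_unit[uJ _] := mink_mx_sqr R.
  by rewrite -unitfE -unitmxE.
have /eqP : \det M ^+ 2 = 1 by apply: (mulIf J0);
  rewrite mul1r -[RHS]E expr2 mulrAC.
by rewrite sqrf_eq1 => /orP[] /eqP; [left|right].
Qed.

(** The determinant is continuous, takes only the values 1 and -1, and starts at 1; a jump to -1
    would force a zero in between. *)
Lemma frame_det nu (s : R) : 0 <= s -> \det (A nu s) = 1.
Proof.
move=> s0; have [//|dN] := lorentz_det _ (frame_lorentz nu s).
have cdet : continuous (fun t => \det (A nu t) : R).
  move=> t; apply: cvg_big => // [|sg _]; first exact: add_continuous.
  apply: cvgM; first exact: cvg_cst.
  apply: cvg_big => // [|i _]; first exact: mul_continuous.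
  move: t; apply: is_derive_continuous => t; apply: is_derive_coord.
  exact: (hA nu).2.
have [||c _ c0] := @IVT _ (fun t => \det (A nu t)) 0 s 0 s0.
- exact: continuous_subspaceT.
- by rewrite (hA nu).1 det1 dN minElt maxElt; case: ifP; lra.
by have [] := lorentz_det _ (frame_lorentz nu c); rewrite c0; lra.
Qed.

(** For parameter 0 constant sections are parallel, so the pairing of a frame section with any
    constant [z] keeps its initial value. This stands in for uniqueness of solutions. *)
Lemma frame_at0 s : A 0 s = 1.
Proof.
suff H (w : 'cV[R]_4) : A 0 s *m w = w.
  apply/matrixP => i j; have /colP/(_ i) := H (delta_mx j 0).
  by rewrite -colE !mxE andbT.
have hc (z : 'cV[R]_4) : flow _ m X 0 (cst z).
  by move=> t; rewrite oppr0 scale0r; exact: is_derive_cst.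
apply: mink_ext => z.
by rewrite (flow_mink_cst _ _ _ _ (cst z) (fun s =>
  A 0 s *m w) s (hc z) (frame_flow 0 w)) frame0.
Qed.

Variable T : R.
Hypothesis T0 : 0 <= T.

Lemma monodromy_mink_continuous (z w : 'cV[R]_4) :
  continuous (fun nu => mink z (A nu T *m w)).
Proof.
move=> nu; have [C etaC] := eta_bounded _ _ _ _ hL _ T0.
(* Writing [z] as the transport of [u] turns (z, A w) at [nu] into (u, w), so the increment is the
   change of a pairing over one period. The constant |nu| + 1 bounds every parameter within distance
   1. *)
pose u := invmx (A nu T) *m z.
have zE : z = A nu T *m u.
  by rewrite mulKVmx //; apply: lorentz_unitmx (frame_lorentz nu T).
pose K := 2 * C * ((sqnorm _ u + sqnorm _ w) * expR (8 * (`|nu| + 1) * C * T))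
  * T.
apply: (@lipschitz_at_continuous _ _ K) => nu' dnu.
rewrite {1 2}zE frame_lorentz distrC.
have := flow_mink_lipschitz _ _ _ T C (`|nu| + 1) T0 _ etaC nu nu' _ _
  (frame_flow nu u) (frame_flow nu' w).
rewrite !frame0; apply; rewrite ?addr_ge0 ?lerDl //.
have -> : nu' = nu - (nu - nu') by ring.
by rewrite (le_trans (ler_normB _ _)) // lerD2l.
Qed.

Lemma monodromy_trace_continuous : continuous (fun nu => \tr (A nu T) : R).
Proof.
move=> nu; apply: cvg_big => // [|i _]; first exact: add_continuous.
rewrite (_ : (fun nu => _) = (fun nu =>
  mink_mx R i i * mink (delta_mx i 0) (A nu T *m delta_mx i 0))).
  by rewrite (mx_coord_mink (A nu T)); apply: cvgM;
    [exact: cvg_cst|exact: monodromy_mink_continuous].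
by apply/funext => x; exact: mx_coord_mink.
Qed.

(** With M the monodromy, the parallel section through the inverse image of [z] under M ends at [z].
    Its pairing with [Y] is constant, so (z, M Y(0)) = (z, Y(T)) = (z, Y(0)). *)
Lemma monodromy_fix nu Y : flow _ m X nu Y -> Y T = Y 0 ->
  monodromy A T nu *m Y 0 = Y 0.
Proof.
move=> hY YT; have hM := frame_lorentz nu T; have uM := lorentz_unitmx _ _ hM.
apply: mink_ext => z; rewrite -[z](mulKVmx uM) hM.
rewrite -{2}YT (flow_mink_cst _ _ _ _ (fun s =>
  A nu s *m (invmx (A nu T) *m z)) Y T _ hY) ?frame0 //.
exact: frame_flow.
Qed.

(** * Conserved quantities and resonance points *)

Section ConservedQuantity.
Variables (d : nat) (p : 'I_d.+1 -> R -> 'cV[R]_4).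
Hypothesis hp : polynomial_conserved_quantity m X p.
Hypothesis hpT : forall t s : R, poly_at p t (s + T) = poly_at p t s.

Lemma conserved_flow nu : flow _ m X nu (poly_at p nu).
Proof.
apply: parallel_flow; first exact: hp.2.
move=> s; apply/derivable_mxP => i j.
rewrite (_ : (fun x => _) = (fun x => \sum_(n < d.+1) nu ^+ n * p n x i j));
  last first.
  by apply/funext => x; rewrite /poly_at summxE; apply: eq_bigr => n _;
    rewrite mxE.
suff : is_derive s (1 : R) (fun x => \sum_(n < d.+1) nu ^+ n * p n x i j)
    (\sum_(n < d.+1) (0 * p n s i j + nu ^+ n * derive1 (p n) s i j)) by case.
apply: is_derive_sumr => n.
have hn := is_derive_coord _ _ _ _ _ _ i j (smooth_is_derive _ _ _ s (hp.1 n)).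
exact: is_derive_mulr _ _ _ _ _ _ (is_derive_cst (nu ^+ n : R) s (1 : R)) hn.
Qed.

Lemma monodromy_conserved nu :
  monodromy A T nu *m poly_at p nu 0 = poly_at p nu 0.
Proof.
by apply: monodromy_fix; [exact: conserved_flow|rewrite -[T]add0r hpT].
Qed.

(** Take a coordinate of the conserved quantity at 0 that is nonzero at [mu], as a polynomial in the
    parameter. So the conserved quantity vanishes at only finitely many parameters. *)
Lemma conserved_polynomial mu : poly_at p mu 0 != 0 ->
  exists P : {poly R}, P != 0 /\ forall nu, poly_at p nu 0 = 0 -> root P nu.
Proof.
move=> pmu.
have /existsP[i pi] : [exists i, poly_at p mu 0 i 0 != 0].
  apply: contraNT pmu; rewrite negb_exists => /forallP pi0.
  by apply/eqP/colP => i; have := pi0 i; rewrite negbK [RHS]mxE => /eqP.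
pose P := \poly_(n < d.+1) p (inord n) 0 i 0.
have PE nu : P.[nu] = poly_at p nu 0 i 0.
  rewrite horner_poly /poly_at summxE; apply: eq_bigr => n _.
  by rewrite mxE inord_val mulrC.
exists P; split; first by apply: contraNneq pi => P0; rewrite -PE P0 horner0.
by move=> nu pnu; rewrite rootE PE pnu mxE.
Qed.

Hypothesis hfin : finite_type A T.

(* The trace is 4 at parameter 0, so below 4 at [mu] it takes infinitely many
   of the values 2 + 2 cos (2 pi / n) in between. *)
Lemma resonance_of_trace_lt mu : poly_at p mu 0 != 0 -> \tr (A mu T) < 4 ->
  exists nu, multiple_cover_resonance_point A T nu.
Proof.
move=> pmu tr4.
(* The bound is tr < 2 + 2 cos solved for the cosine; it is below 1 because the trace is below 4. *)
have [N cN] : exists N, forall n, (N <= n)%N ->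
    (\tr (A mu T) - 2) / 2 < cos (2 * pi / n.+2%:R).
  by apply: cos_two_pi_div_near1; rewrite ltr_pdivrMr //; lra.
have ex n : exists nu, \tr (A nu T) = 2 + 2 * cos (2 * pi / (N + n).+2%:R).
  (* The path t * mu joins 0 to [mu] whatever the sign of [mu]. *)
  have [||c _ cE] := @IVT _ (fun t => \tr (A (t * mu) T)) 0 1
    (2 + 2 * cos (2 * pi / (N + n).+2%:R)) ler01.
  - apply: continuous_subspaceT => t.
    apply: (@cvg_comp _ _ _ (fun t => t * mu) (fun nu => \tr (A nu T))).
      by apply: cvgM; [exact: cvg_id|exact: cvg_cst].
    exact: monodromy_trace_continuous.
  - rewrite mul0r mul1r frame_at0 mxtrace1.
    have /cN : (N <= N + n)%N by rewrite leq_addr.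
    rewrite ltr_pdivrMr // => lb.
    have ub := cos_le1 (2 * pi / (N + n).+2%:R : R).
    rewrite minElt maxElt; case: ifP; lra.
  by exists (c * mu).
have [nu nuE] := boolp.choice ex.
have inj_nu : injective nu.
  move=> n k E; have := nuE k; rewrite -E nuE => /addrI.
  have two0 : 2 != 0 :> R by rewrite pnatr_eq0.
  by move/(mulfI two0)/cos_two_pi_div_inj/addnI.
have [/= B BE] := (finite_seqP _).1 hfin.
have [P [P0 hP]] := conserved_polynomial _ pmu.
(* Adjoining 0 to [B] makes the parameter found nonzero, as a resonance point must be. *)
have [n [nB nP]] := injection_avoids _ _ (0 :: B) _ inj_nu P0.
move: nB; rewrite inE negb_or => /andP[nu0 nB].
exists (nu n); split=> //; exists (N + n).+2; split=> //.
have dM : diagonalizableC (monodromy A T (nu n)).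
  apply: contrapT => nd; move/negP: nB; apply.
  by have : [set` B] (nu n) by rewrite -BE.
have q0 : poly_at p (nu n) 0 != 0 by apply: contra nP => /eqP; exact: hP.
have [x [Q [dd [uQ x0 ME dE]]]] := lorentz_spectrum _ _ _ (frame_lorentz (nu n)
  T)
  (frame_det (nu n) _ T0) q0 (monodromy_conserved (nu n)) dM.
apply: (lorentz_spectrum_pow _ _ _ _ _ uQ ME dE).
apply: root_of_unity_trace => //.
have := lorentz_spectrum_trace _ _ _ _ _ uQ ME dE.
rewrite nuE rmorphD rmorph_nat => /addrI <-.
by [].
Qed.

End ConservedQuantity.
End Monodromy.

(** * The monodromy at the given parameter *)

Lemma lorentz_fix_of_pair (R : realType) (M : 'M[R]_4) (q v : 'cV[R]_4) :
  lorentz _ M -> M *m q = q -> is_eigenvector M v -> mink q v != 0 ->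
  M *m v = v.
Proof.
move=> hM Mq [_ [k Mv]] qv; suff k1 : k = 1 by rewrite Mv k1 scale1r.
by apply: (mulIf qv); rewrite mul1r -[RHS]hM Mq Mv minkZr.
Qed.

Theorem theorem3p1 (R : realType) (T : R) (m : R -> R)
  (L : R -> {vspace 'cV[R]_4}) (X : R -> 'cV[R]_4)
  (d : nat) (p : 'I_d.+1 -> R -> 'cV[R]_4) (A : R -> R -> 'M[R]_4)
  (mu : R) (L1 L2 : R -> {vspace 'cV[R]_4}) (X1 X2 : R -> 'cV[R]_4)
  (hL : polarised_curve m L X)
  (hT : closed_curve T m L)
  (hA : parallel_frames m X A)
  (hfin : finite_type A T)
  (hp : polynomial_conserved_quantity m X p)
  (hpT : forall t s : R, poly_at p t (s + T) = poly_at p t s)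
  (hmu : mu != 0)
  (hdiag : diagonalizableC (monodromy A T mu))
  (hD1 : darboux_transform m X mu L1 X1)
  (hD2 : darboux_transform m X mu L2 X2)
  (hev1 : is_eigenvector (monodromy A T mu) (X1 0))
  (hev2 : is_eigenvector (monodromy A T mu) (X2 0))
  (hfree : free [:: X1 0; X2 0]) :
  (exists c : R, forall s, mink (poly_at p mu s) (X1 s) = c) /\
  ((exists s, mink (poly_at p mu s) (X1 s) != 0) ->
    (exists lam : R[i], `|lam| = 1 /\
       forall a : R[i], eigenvalue (complexify (monodromy A T mu)) a =
                        (a \in [:: 1; lam; lam^*])) /\
    (exists nu : R, multiple_cover_resonance_point A T nu)).
Proof.
have [T0 _] := hT; have T0' := ltW T0.
have [_ [sX1 L1E] ll1 par1] := hD1; have [_ [_ L2E] ll2 _] := hD2.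
have flow1 : flow _ m X mu X1.
  by apply: parallel_flow => // s; apply: sX1 0%N s.
have flowp := conserved_flow _ _ _ _ _ hp mu.
have cst s : mink (poly_at p mu s) (X1 s) = mink (poly_at p mu 0) (X1 0).
  exact: flow_mink_cst flowp flow1.
split; first by exists (mink (poly_at p mu 0) (X1 0)).
case=> s; rewrite cst => pX1.
have hM := frame_lorentz _ _ _ _ hA mu T.
have Mp := monodromy_conserved _ _ _ _ hA T _ _ hp hpT mu.
have p0 : poly_at p mu 0 != 0.
  by apply: contraNneq pX1 => ->; rewrite -(scale0r (X1 0)) minkZl mul0r.
have x11 : mink (X1 0) (X1 0) = 0.
  by apply: (ll1 0); rewrite (L1E 0).2 memv_line.
have x22 : mink (X2 0) (X2 0) = 0.
  by apply: (ll2 0); rewrite (L2E 0).2 memv_line.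
(* Orthogonal lightlike vectors are proportional, which [hfree] excludes. *)
have x12 : mink (X1 0) (X2 0) != 0.
  move: hfree; rewrite free_cons span_seq1 => /andP[+ _].
  apply: contra => /eqP x12; apply: lightlike_ortho => //;
    last by rewrite minkC.
  exact: (L2E 0).1.
have M1 := lorentz_fix_of_pair _ _ _ _ hM Mp hev1 pX1.
have M2 := lorentz_fix_of_pair _ _ _ _ hM M1 hev2 x12.
have [x [P [D [uP x0 ME DE]]]] := lorentz_spectrum _ _ _ hM
  (frame_det _ _ _ _ hA mu _ T0') p0 Mp hdiag.
have [w w0 Mw] := lorentz_spectrum_eigenvector _ _ _ _ _ uP ME DE.
have x1 := lorentz_fix2_norm1 _ _ _ _ _ _ hM x11 x22 x12 M1 M2 w0 Mw.
split; first by exists x; split=> //;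
  exact: lorentz_spectrum_eigenvalue uP ME DE x1.
have [xE|xn1] := eqVneq x 1.
  exists mu; split=> //; exists 1; split=> //.
  exact: (lorentz_spectrum_pow _ _ _ _ _ uP ME DE).
(* On the unit circle the trace is 2 + 2 Re x, and Re x = 1 would force Im x = 0, that is x = 1. *)
apply: (resonance_of_trace_lt _ _ _ _ _ hL hA _ T0' _ _ hp hpT hfin mu p0).
have /(congr1 (@complex.Re R)) := lorentz_spectrum_trace _ _ _ _ _ uP ME DE.
rewrite invC_norm x1 expr1n invr1 mul1r.
move: x1 xn1; rewrite normc_def => /(congr1 (@complex.Re R)) /=.
case: (x) => a b /= ab; rewrite eq_complex /= negb_and => ab1.
have {}ab : a ^+ 2 + b ^+ 2 = 1.
  by rewrite -[LHS]sqr_sqrtr ?ab ?expr1n // addr_ge0 ?sqr_ge0.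
have a1 : a < 1.
  have b2 := sqr_ge0 b; rewrite lt_neqAle; apply/andP; split; last by nra.
  apply: contraTneq ab1 => a1; rewrite a1 eqxx /= negbK -sqrf_eq0.
  by apply/eqP; move: ab; rewrite a1; lra.
by move=> ->; lra.
Qed.
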